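(* Let $X$, $(Y,d_Y)$, $(Z,d_Z)$ be Polish (metric) spaces, let $M$ be a compact Hausdorff space, and let $P: X \rightsquigarrow Y$, $Q: Y \rightsquigarrow Z$ be tight Feller kernels with all values in $\mathcal{P}_1$. Assume $W_1(Q(y), Q(y')) \le L\, d_Y(y,y')$ for all $y,y' \in Y$. Then for any $\delta, \epsilon \ge 0$ and any closed $S \subseteq Z \times M$, $$P^{*,\delta}_W(Q^{*,\epsilon}_W S) \subseteq (Q \circ P)^{*,L\delta+\epsilon}_W S.$$
   Context: Tight Feller kernels as usual ($P(x,\cdot)$ Borel probability measures; Feller: $x \mapsto \int\phi\,dP(x,\cdot)$ continuous for bounded continuous $\phi$; tight: uniform compact concentration over compact input sets); $(Q\circ P)(x,C) = \int Q(y,C)\,P(x,dy)$. $\mathcal{P}_1(Y)$ is the set of Borel probability measures with finite first moment; $W_1(\mu,\nu) = \inf_{\pi \in \Pi(\mu,\nu)} \int d(y,y')\,d\pi$ over couplings. For closed $A \subseteq Y$, $\mathcal{P}_A = \{\nu \in \mathcal{P}_1(Y) : \mathrm{supp}(\nu) \subseteq A\}$ and $W_1(\mu, \mathcal{P}_A) = \inf_{\nu \in \mathcal{P}_A} W_1(\mu,\nu)$. For a kernel $P: X \rightsquigarrow Y$ and relation $S \subseteq Y \times M$, the Wasserstein pullback is $P^{*,\epsilon}_W S = \{(x,m) \in X \times M : W_1(P(x), \mathcal{P}_{S_m}) \le \epsilon\}$, $S_m = \{y : (y,m) \in S\}$.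
   Formalization: The Lipschitz constant L is assumed to be non-negative, as is implicit in the English; for negative L (possible only when Y has at most one point) the stated inclusion can fail. *)

(* Defs.v *)
From HB Require Import structures.
From mathcomp Require Import all_boot all_order all_algebra.
From mathcomp Require Import all_classical all_reals all_analysis.
Set Implicit Arguments. Unset Strict Implicit. Unset Printing Implicit Defensive.
Import Order.TTheory GRing.Theory Num.Theory numFieldTopology.Exports numFieldNormedType.Exports.
Local Open Scope classical_set_scope.
Local Open Scope ring_scope.
Local Open Scope ereal_scope.

(** Nonempty (pointed) metric spaces: needed because the library's
    generated sigma-algebra instance requires a pointed carrier. *)
#[short(type="pointedMetricType")]
HB.structure Definition PointedMetric (K : numDomainType) :=
  { M of Pointed M & Metric K M }.

Notation borel T := (g_sigma_algebraType (@open T)).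

Section defs.
Context {R : realType}.

Definition complete_space (T : uniformType) :=
  forall F : set_system T, ProperFilter F -> cauchy F -> exists x : T, F --> x.

Definition separable_space (T : topologicalType) :=
  exists D : set T, countable D /\ dense D.

Definition polish (T : metricType R) := complete_space T /\ separable_space T.

Definition supp {T : ptopologicalType} (nu : set (borel T) -> \bar R) : set T :=
  [set y | forall U : set T, open U -> U y -> 0 < nu U].

Definition P1 {T : pointedMetricType R} (nu : probability (borel T) R) :=
  exists y0 : T, \int[nu]_(y in setT) (@mdist R T y0 y)%:E < +oo.

Definition coupling {T : pointedMetricType R} (mu nu : set (borel T) -> \bar R)
  (pi : probability (borel T * borel T)%type R) :=
  forall A : set (borel T), measurable A ->
    pi (A `*` setT) = mu A /\ pi (setT `*` A) = nu A.

Definition W1 {T : pointedMetricType R} (mu nu : set (borel T) -> \bar R) : \bar R :=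
  ereal_inf [set \int[pi]_(z in setT) (@mdist R T z.1 z.2)%:E
            | pi in [set pi | coupling mu nu pi]].

Definition PA {T : pointedMetricType R} (A : set T) : set (probability (borel T) R) :=
  [set nu | P1 nu /\ supp nu `<=` A].

Definition W1set {T : pointedMetricType R} (mu : set (borel T) -> \bar R) (A : set T) :=
  ereal_inf [set W1 mu nu | nu in PA A].

Definition Wpullback {X : Type} {T : pointedMetricType R} {M : Type}
  (P : X -> set (borel T) -> \bar R) (eps : R) (S : set (T * M)) : set (X * M) :=
  [set xm | W1set (P xm.1) [set y | S (y, xm.2)] <= eps%:E].

Definition feller {X : topologicalType} {T : ptopologicalType} (P : X -> probability (borel T) R) :=
  forall phi : T -> R, continuous phi -> (exists C : R, forall y, `|phi y| <= C)%R ->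
    continuous (fun x => \int[P x]_(y in setT) (phi y)%:E).

Definition tight {X : topologicalType} {T : ptopologicalType} (P : X -> probability (borel T) R) :=
  forall K : set X, compact K -> forall e : R, (0 < e)%R ->
    exists C : set T, compact C /\ forall x, K x -> P x (~` C) < e%:E.

Definition kcompose {X : Type} {Y Z : ptopologicalType}
  (P : X -> probability (borel Y) R) (Q : Y -> probability (borel Z) R) :
  X -> set (borel Z) -> \bar R :=
  fun x C => \int[P x]_(y in setT) Q y C.

Definition kfun {X : Type} {T : ptopologicalType} (P : X -> probability (borel T) R) :
  X -> set (borel T) -> \bar R := fun x => (P x : set _ -> \bar R).

End defs.

(* Main.v *)
(** For closed [A], [W1(mu, P_A)] is the integral of the distance [d(., A)]
    against [mu]: a coupling with a measure supported in [A] costs at least that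
    much, and pushing [mu] forward along a measurable almost-projection onto [A]
    costs at most [e] more.  Write [g y] for the integral of [d(., S_m)] against
    [Q y].  By the easy half of Kantorovich duality [g] is [L]-Lipschitz, and
    [g <= eps] on [B := (Q^{*,eps} S)_m], so [g <= L * d(., B) + eps]
    everywhere; integrating against [P x], where the integral of [d(., B)] is at
    most [delta], gives the bound. *)
Require Import Defs.
From HB Require Import structures.
From mathcomp Require Import all_boot all_order all_algebra.
From mathcomp Require Import all_classical all_reals all_analysis.
From mathcomp Require Import measurable_realfun giry lra.
Import Order.TTheory GRing.Theory Num.Theory numFieldTopology.Exports numFieldNormedType.Exports.
Local Open Scope classical_set_scope.
Local Open Scope ring_scope.

(** * Distance to a set, and dense sequences *)

Section setdist.
Context {R : realType} {T : metricType R}.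
Implicit Types (A : set T) (x y : T) (e : R).

(* [setdist set0 y = 0], since [inf set0 = 0]. *)
Definition setdist A y : R := inf [set mdist y a | a in A].

Lemma setdist_lbound A y : has_lbound [set mdist y a | a in A].
Proof. by exists 0 => _ [a _ <-]; exact: mdist_ge0. Qed.

Lemma setdist_le_mdist A y a : A a -> setdist A y <= mdist y a.
Proof. by move=> Aa; apply: ge_inf; [exact: setdist_lbound|exists a]. Qed.

Lemma setdist_ge0 A y : 0 <= setdist A y.
Proof.
have [->|A0] := eqVneq A set0; first by rewrite /setdist image_set0 inf0.
apply: lb_le_inf; last by move=> _ [a _ <-]; exact: mdist_ge0.
by case/set0P: A0 => a Aa; exists (mdist y a); exists a.
Qed.

Lemma setdist_approx A y e : A !=set0 -> 0 < e ->
  exists2 a, A a & mdist y a < setdist A y + e.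
Proof.
move=> [a Aa] e0; have hi : has_inf [set mdist y a | a in A].
  by split; [exists (mdist y a); exists a|exact: setdist_lbound].
by have [_ [b Ab <-] h] := inf_adherent e0 hi; exists b.
Qed.

Lemma setdist_lip A y y' : A !=set0 -> setdist A y <= setdist A y' + mdist y y'.
Proof.
move=> A0; apply/ler_addgt0Pr => e e0.
have [a Aa h] := setdist_approx A y' e A0 e0.
have := setdist_le_mdist _ y _ Aa; have := metric_triangle y y' a; lra.
Qed.

Lemma setdist0 A y : A y -> setdist A y = 0.
Proof.
move=> Ay; apply/eqP; rewrite eq_le setdist_ge0 andbT.
by rewrite -(mdistxx y); exact: setdist_le_mdist.
Qed.

Lemma setdist_gt0 A y : closed A -> A !=set0 -> ~ A y -> 0 < setdist A y.
Proof.
move=> cA A0 nAy; rewrite lt_neqAle setdist_ge0 andbT eq_sym.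
apply/eqP => d0; apply: nAy; apply: cA => B /nbhs_ballP[e /= e0 yB].
have [a Aa h] := setdist_approx A y e A0 e0.
by exists a; split=> //; apply: yB; rewrite ballEmdist/=; move: h; rewrite d0 add0r.
Qed.

(** The bound is one-sided, but exchanging [x] and [y] makes it two-sided because the metric is
    symmetric. *)
Lemma lipschitz1_continuous (f : T -> R) :
  (forall x y, f x <= f y + mdist x y) -> continuous f.
Proof.
move=> lf x; apply/cvgrPdist_lt => e e0.
apply/nbhs_ballP; exists e => //= y; rewrite ballEmdist/= => xy.
rewrite ltr_norml; have := lf x y; have := lf y x.
rewrite (metric_sym y x); lra.
Qed.

Lemma mdist_lip (z x y : T) : mdist z x <= mdist z y + mdist x y.
Proof. by rewrite (metric_sym x y); exact: metric_triangle. Qed.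

(** The ball is the preimage of an open ray under the continuous function [mdist x]. *)
Lemma metric_ball_open x e : open (ball x e).
Proof.
rewrite ballEmdist.
have /continuousP := lipschitz1_continuous _ (mdist_lip x).
by move=> /(_ [set r | r < e]); apply; exact: open_lt.
Qed.

Lemma separable_seq : separable_space T -> T ->
  exists q : nat -> T, forall y (e : R), 0 < e -> exists n, mdist y (q n) < e.
Proof.
move=> [D [cD dD]] t0.
have dball y e : 0 < e -> exists2 d, D d & mdist y d < e.
  move=> e0; have [||d [/interior_subset yd Dd]] := dD (interior (ball y e)).
  - by exists y; exact: nbhsx_ballx.
  - exact: open_interior.
  by exists d => //; move: yd; rewrite ballEmdist.
(* A surjection from [nat] onto [D] requires [D] nonempty; density near [t0] ensures this. *)
have /pfcard_geP[D0|[f]] := cD.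
  by have [d] := dball t0 1 ltr01; rewrite D0.
exists f => y e /(dball y)[d Dd yd].
by have [n _ nd] := @surj _ _ _ _ f _ Dd; exists n; rewrite nd.
Qed.

End setdist.

(** * Borel measurability of Lipschitz functions and of the metric *)

Section borel_measurability.
Context {R : realType} {T : pointedMetricType R}.

Lemma borel_open (U : set T) : open U -> measurable (U : set (borel T)).
Proof. exact: sub_sigma_algebra. Qed.

Lemma continuous_borel_measurable (f : T -> R) : continuous f ->
  measurable_fun (setT : set (borel T)) f.
Proof.
move=> /continuousP cf; apply: (measurability _ (RGenOpens.measurableE R)).
move=> _ [_ [a [b ->] <-]]; rewrite setTI; apply: borel_open.
exact/cf/interval_open.
Qed.

Lemma continuous_borel_emeasurable (f : T -> \bar R) : continuous f ->
  measurable_fun setT (f : borel T -> \bar R).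
Proof.
move=> /continuousP cf; apply: (measurability _ (ErealGenOInfty.measurableE R)).
move=> _ [_ [a ->] <-]; rewrite setTI preimage_itvoy; apply: borel_open.
by apply: (cf [set y | (a%:E < y)%E]); exact: open_ereal_gt_ereal.
Qed.

Lemma lipschitz1_measurable (f : T -> R) :
  (forall x y, f x <= f y + mdist x y) -> measurable_fun (setT : set (borel T)) f.
Proof.
by move=> lf; apply: continuous_borel_measurable; exact: lipschitz1_continuous.
Qed.

Lemma measurable_mdistr (z : T) : measurable_fun (setT : set (borel T)) (mdist z).
Proof. by apply: lipschitz1_measurable => x y; exact: mdist_lip. Qed.

Lemma measurable_setdist (A : set T) : A !=set0 ->
  measurable_fun (setT : set (borel T)) (setdist A).
Proof. by move=> A0; apply: lipschitz1_measurable => x y; exact: setdist_lip. Qed.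

(* By separability the metric is the infimum over a dense sequence [q] of
   [d x (q n) + d (q n) y]; the product sigma-algebra may otherwise be too
   small to measure it. *)
Lemma measurable_mdist : separable_space T ->
  measurable_fun (setT : set (borel T * borel T)%type)
    (fun z => @mdist R T z.1 z.2).
Proof.
move=> /separable_seq /(_ point)[q qd].
pose h n (z : borel T * borel T) : R := mdist (q n) z.1 + mdist (q n) z.2.
have lb z : has_lbound (range (h ^~ z)).
  by exists 0 => _ [n _ <-]; rewrite addr_ge0 ?mdist_ge0.
have mh n : measurable_fun setT (h n).
  apply: measurable_funD.
    by apply: measurableT_comp (measurable_mdistr _) _; exact: measurable_fst.
  by apply: measurableT_comp (measurable_mdistr _) _; exact: measurable_snd.
have mi := @measurable_fun_infs _ _ R setT h 0 (fun z _ => lb z) mh.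
apply: eq_measurable_fun mi => z _.
have -> : infs (h ^~ z) 0 = inf (range (h ^~ z)).
  by congr inf; apply/seteqP; split=> _ [n _ <-]; exists n.
apply/eqP; rewrite eq_le; apply/andP; split.
  apply/ler_addgt0Pr => e e0.
  (* Half of [e], because d(q n, z.1) enters twice: directly and in the bound on d(q n, z.2). *)
  have e20 : 0 < e / 2 by rewrite divr_gt0.
  have [n hn] := qd z.1 _ e20.
  have le1 : inf (range (h ^~ z)) <= h n z by apply: ge_inf; [exact: lb|exists n].
  have := metric_triangle (q n) z.1 z.2; rewrite (metric_sym (q n) z.1).
  by move: le1; rewrite /h (metric_sym (q n) z.1); lra.
apply: lb_le_inf; first by exists (h 0 z); exists 0.
by move=> _ [n _ <-]; rewrite /h (metric_sym (q n)); exact: metric_triangle.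
Qed.

End borel_measurability.

(** * Supports of Borel measures *)

Section support.
Context {R : realType} {T : pointedMetricType R}.

(* Separability (the Lindelof property) is what makes the complement of the
   support, a union of null open sets, a null set. *)
Lemma supp_negligible (nu : {measure set (borel T) -> \bar R}) :
  separable_space T -> nu.-negligible (~` supp nu).
Proof.
move=> /separable_seq /(_ point)[q qd].
pose B n k : set T := ball (q n) k.+1%:R^-1.
have mB n k : measurable (B n k : set (borel T)).
  by apply: borel_open; exact: metric_ball_open.
(* Only the null balls of the countable family are kept; they still cover the complement of the
   support. *)
pose N n k : set (borel T) := if nu (B n k) == 0%E then B n k else set0.
apply: (@negligibleS _ _ _ _ (\bigcup_n \bigcup_k N n k)); last first.
  apply: negligible_bigcup => n; apply: negligible_bigcup => k.
  rewrite /N; case: eqP => [B0|_]; last exact: negligible_set0.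
  by exists (B n k); split.
move=> y /existsNP[U /not_implyP[oU /not_implyP[Uy /negP]]].
rewrite -leNgt measure_le0 => /eqP nuU.
have [e /= e0 yU] : nbhs_ball y U by apply/nbhs_ballP; exact: open_nbhs_nbhs.
(* A ball of radius below [e / 2] containing [y] lies in the ball of radius [e] around [y], hence in
   the null set [U]. *)
have e20 : 0 < e / 2 by rewrite divr_gt0.
have [k _ /(_ k (leqnn _))/= hk] := near_infty_natSinv_lt (PosNum e20).
have [|n hn] := qd y k.+1%:R^-1; first by rewrite invr_gt0.
have BU : B n k `<=` U.
  move=> z; rewrite /B ballEmdist/= => qz; apply: yU; rewrite ballEmdist/=.
  rewrite (le_lt_trans (metric_triangle y (q n) z))// (splitr e).
  by rewrite ltrD// (lt_trans _ hk).
exists n => //; exists k => //; rewrite /N.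
have -> : nu (B n k) = 0%E.
  apply/eqP; rewrite -measure_le0 -nuU; apply: le_measure => //.
  - by rewrite inE; exact: mB.
  - by rewrite inE; exact: borel_open.
by rewrite eqxx /B ballEmdist/= metric_sym.
Qed.

(** With empty support the whole space would be null, against total mass 1. *)
Lemma supp_nonempty (nu : probability (borel T) R) :
  separable_space T -> supp nu !=set0.
Proof.
move=> sT; apply/set0P/eqP => s0.
have := supp_negligible nu sT; rewrite s0 setC0 => /(negligibleP _ measurableT).
by move/eqP; rewrite [X in X == _]probability_setT onee_eq0.
Qed.

(** The distance to [A] vanishes on the support, whose complement is null. *)
Lemma integral_setdist_supp (nu : probability (borel T) R) (A : set T) :
  separable_space T -> supp nu `<=` A ->
  (\int[nu]_(y in setT) (setdist A y)%:E = 0)%E.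
Proof.
move=> sT sA; have A0 : A !=set0.
  by have [y sy] := supp_nonempty nu sT; exists y; exact: sA.
rewrite (@ge0_ae_eq_integral _ _ _ nu setT _ (cst 0%E))//.
- by rewrite integral0.
- by apply/measurable_EFinP; exact: measurable_setdist.
- by move=> y _; rewrite lee_fin setdist_ge0.
apply: negligibleS (supp_negligible nu sT) => y /= h sy; apply: h => _.
by rewrite setdist0//; exact: sA.
Qed.

End support.

(** * Lower bound for the Wasserstein distance to measures supported in a set *)

Section wasserstein_lower.
Context {R : realType} {T : pointedMetricType R}.
Local Open Scope ereal_scope.

(** The marginals of [pi] are its pushforwards along the projections, so this is a change of
    variables. *)
Lemma coupling_integral (mu nu : probability (borel T) R)
    (pi : probability (borel T * borel T)%type R) (f : borel T -> \bar R) :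
  coupling mu nu pi -> measurable_fun setT f -> (forall y, 0 <= f y) ->
  \int[pi]_z f z.1 = \int[mu]_y f y /\ \int[pi]_z f z.2 = \int[nu]_y f y.
Proof.
move=> cpi mf f0; split.
- transitivity (\int[pushforward pi fst]_y f y).
    by rewrite ge0_integral_pushforward//; exact: measurable_fst.
  apply: eq_measure_integral => A mA _; have [h _] := cpi A mA.
  by apply: etrans h; congr (pi _); apply/seteqP; split=> z //= [].
- transitivity (\int[pushforward pi snd]_y f y).
    by rewrite ge0_integral_pushforward//; exact: measurable_snd.
  apply: eq_measure_integral => A mA _; have [_ h] := cpi A mA.
  by apply: etrans h; congr (pi _); apply/seteqP; split=> z //= [].
Qed.

(* The easy direction of Kantorovich duality, for nonnegative test functions
   so that no integrability is required. *)
Lemma W1_lipschitz (mu nu : probability (borel T) R) (phi : T -> R) :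
  separable_space T -> (forall y, 0 <= phi y)%R ->
  (forall x y, phi x <= phi y + mdist x y)%R ->
  \int[mu]_y (phi y)%:E <= \int[nu]_y (phi y)%:E + W1 mu nu.
Proof.
move=> sT phi0 lphi.
have mphi : measurable_fun setT (fun y : borel T => (phi y)%:E).
  by apply/measurable_EFinP; exact: lipschitz1_measurable.
have ephi0 (y : borel T) : 0 <= (phi y)%:E by rewrite lee_fin.
have md : measurable_fun setT (fun z : borel T * borel T => (@mdist R T z.1 z.2)%:E).
  by apply/measurable_EFinP; exact: measurable_mdist.
have := integral_ge0 nu (fun y (_ : setT y) => ephi0 y).
case E : (\int[nu]_y (phi y)%:E) => [b| |]// _; last first.
  (* If the integral against [nu] is infinite, so is the right side: [W1], an infimum of nonnegative
     costs, is not -oo. *)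
  rewrite addye ?leey// -ltNye (@lt_le_trans _ _ 0)//.
  apply: le_ereal_inf_tmp => _ [pi _ <-]; apply: integral_ge0 => z _.
  by rewrite lee_fin mdist_ge0.
rewrite -leeBlDl//; apply: le_ereal_inf_tmp => _ [pi cpi <-].
rewrite leeBlDl// -E.
have [<- <-] := coupling_integral mu nu pi _ cpi mphi ephi0.
have mphi1 : measurable_fun setT (fun z : borel T * borel T => (phi z.1)%:E).
  exact: (measurableT_comp mphi measurable_fst).
have mphi2 : measurable_fun setT (fun z : borel T * borel T => (phi z.2)%:E).
  exact: (measurableT_comp mphi measurable_snd).
rewrite -ge0_integralD//; last by move=> z _; rewrite lee_fin mdist_ge0.
apply: ge0_le_integral => //.
- by apply: emeasurable_funD.
- by move=> z _; rewrite -EFinD lee_fin.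
Qed.

(** Supports of probability measures are nonempty, so an empty [A] leaves [PA A] empty and the
    infimum infinite. This keeps the default value of [setdist set0] out of the estimates. *)
Lemma W1set_nonempty (mu : set (borel T) -> \bar R) (A : set T) (r : R) :
  separable_space T -> W1set mu A <= r%:E -> A !=set0.
Proof.
move=> sT; rewrite /W1set; have [->|/set0P[nu [_ sA]]] := eqVneq (PA A) set0.
  by rewrite image_set0 ereal_inf0 leye_eq.
by have [y sy] := supp_nonempty nu sT; exists y; exact: sA.
Qed.

Lemma integral_setdist_le_W1set (mu : probability (borel T) R) (A : set T) :
  separable_space T -> A !=set0 ->
  \int[mu]_y (setdist A y)%:E <= W1set mu A.
Proof.
move=> sT A0; apply: le_ereal_inf_tmp => _ [nu [_ sA] <-].
have := W1_lipschitz mu nu (setdist A) sT (setdist_ge0 A)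
  (fun x y => setdist_lip A x y A0).
by rewrite (integral_setdist_supp nu)// add0e.
Qed.

End wasserstein_lower.

(** * Measurable almost-projections *)

Section almost_projection.
Context {R : realType} {T : pointedMetricType R}.

(* Send [y] to an almost nearest point of [A] for the first element of a dense
   sequence that is close to [y]: the map takes countably many values. *)
Lemma measurable_almost_projection (A : set T) (e : R) :
  separable_space T -> A !=set0 -> 0 < e ->
  exists f : borel T -> borel T, [/\ measurable_fun setT f,
    forall y, A (f y) & forall y, @mdist R T y (f y) <= setdist A y + e].
Proof.
move=> /separable_seq /(_ point)[q qd] A0 e0.
have e30 : 0 < e / 3 by rewrite divr_gt0.
have /choice[a ha] n : exists b, A b /\ mdist (q n) b < setdist A (q n) + e / 3.
  by have [b] := setdist_approx A (q n) _ A0 e30; exists b.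
pose idx y := ex_minn (qd y _ e30).
exists (fun y => a (idx y)); split; last 2 first.
- by move=> y; have [] := ha (idx y).
- move=> y; have [_ h] := ha (idx y); move: h.
  rewrite /idx; case: ex_minnP => n yn _ h.
  have := metric_triangle y (q n) (a n).
  have := setdist_lip A (q n) y A0; rewrite (metric_sym (q n) y).
  (* One third each for moving from [y] to [q n], for the choice of [a n], and for comparing
     [setdist A] at [q n] and at [y]. *)
  have -> : e = e / 3 + e / 3 + e / 3 by lra.
  lra.
move=> _ B mB; rewrite setTI.
pose D n : set (borel T) := [set y | mdist (q n) y < e / 3].
have mD n : measurable (D n).
  by apply: borel_open; rewrite /D -ballEmdist; exact: metric_ball_open.
(* The index is a first hitting index: [y] lies in [D n] and in no earlier [D k]. *)
have idxE n : [set y | idx y = n] = D n `\` \bigcup_(k in `I_n) D k.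
  apply/seteqP; split=> y; rewrite /idx/=; case: ex_minnP => m ym min_m.
    move=> <-; split; first by rewrite /D/= metric_sym.
    by move=> [k /= km]; rewrite /D/= metric_sym => /min_m; rewrite leqNgt km.
  move=> [yn nk]; apply/eqP; rewrite eqn_leq min_m/=; last by rewrite metric_sym.
  by rewrite leqNgt; apply/negP => mn; apply: nk; exists m; rewrite // /D/= metric_sym.
have -> : (fun y : borel T => a (idx y)) @^-1` B =
    \bigcup_(n in [set n | B (a n)]) [set y | idx y = n].
  apply/seteqP; split=> [y By|y [n Bn] /= ->//].
  by exists (idx y).
apply: bigcup_measurable => n _; rewrite idxE.
by apply: measurableD => //; apply: bigcup_measurable.
Qed.

End almost_projection.

(** * Matching upper bound *)

Section wasserstein_upper.
Context {R : realType} {T : pointedMetricType R}.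
Local Open Scope ereal_scope.

Lemma W1set_le_integral_setdist (mu : probability (borel T) R) (A : set T) :
  separable_space T -> closed A -> A !=set0 -> P1 mu ->
  W1set mu A <= \int[mu]_y (setdist A y)%:E.
Proof.
move=> sT cA A0 [y0 muy0]; apply/lee_addgt0Pr => e e0.
have [f [mf Af fd]] := measurable_almost_projection A e sT A0 e0.
have mg : measurable_fun setT (fun y : borel T => (y, f y)).
  exact: measurable_fun_pair.
(* [nu] is the law of [f] under [mu]; [pi], the law of [(y, f y)], couples [mu] with [nu]. *)
pose nu : probability (borel T) R := distribution mu (mfun_Sub (mem_set mf)).
pose pi : probability (borel T * borel T)%type R :=
  distribution mu (mfun_Sub (mem_set mg)).
have msd : measurable_fun setT (fun y : borel T => (setdist A y)%:E).
  by apply/measurable_EFinP; exact: measurable_setdist.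
have md : measurable_fun setT (fun y : borel T => (@mdist R T y0 y)%:E).
  by apply/measurable_EFinP; exact: measurable_mdistr.
have mdz : measurable_fun setT (fun z : borel T * borel T => (@mdist R T z.1 z.2)%:E).
  by apply/measurable_EFinP; exact: measurable_mdist.
have Ic (r : R) : \int[mu]_(y in setT) r%:E = r%:E.
  apply: etrans (integral_cst mu measurableT r%:E) _.
  by rewrite -[RHS]mule1; congr (_ * _); exact: probability_setT.
have mdf := measurableT_comp md mf.
have mdg : measurable_fun setT (fun y : borel T => (@mdist R T y (f y))%:E).
  exact: (measurableT_comp mdz mg).
have d0 (x y : T) : 0 <= (mdist x y)%:E by rewrite lee_fin mdist_ge0.
have s0 (y : T) : 0 <= (setdist A y)%:E by rewrite lee_fin setdist_ge0.
apply: ge_ereal_inf; exists (W1 mu nu).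
  exists nu => //; split; last first.
    (* The complement of [A] is open and [nu]-null, since [f] maps into [A], so it misses the
       support. *)
    move=> y /(_ (~` A)) sy; apply: contrapT => nAy.
    have := sy (closed_openC cA) nAy.
    rewrite [X in _ < X](_ : _ = 0) ?ltxx// -(measure0 mu).
    by congr (mu _); apply/seteqP; split=> // z /=; apply; exact: Af.
  exists y0; rewrite ge0_integral_distribution//.
  (* From d(y, f y) <= d(y, A) + e and d(y, A) <= d(y0, A) + d(y0, y) follows d(y0, f y) <= 2 d(y0,
     y) + c. *)
  pose c : R := (setdist A y0 + e)%R.
  have c0 : 0 <= c%:E by rewrite lee_fin addr_ge0 ?setdist_ge0 ?ltW.
  have mdd := emeasurable_funD md md.
  apply: (@le_lt_trans _ _ (\int[mu]_y ((mdist y0 y)%:E + (mdist y0 y)%:E + c%:E))).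
    apply: ge0_le_integral => //.
    - by move=> y _; exact: d0.
    - exact: emeasurable_funD mdd (measurable_cst c%:E).
    - move=> y _; rewrite /= -!EFinD lee_fin /c.
      have := metric_triangle y0 y (f y); have := fd y.
      have := setdist_lip A y y0 A0; rewrite (metric_sym y y0); lra.
  rewrite ge0_integralD//; last first.
    by move=> y _; rewrite adde_ge0.
  rewrite ge0_integralD// Ic.
  by apply: lte_add_pinfty; [exact: lte_add_pinfty|exact: ltry].
apply: (@le_trans _ _ (\int[mu]_y ((setdist A y)%:E + e%:E))); last first.
  rewrite ge0_integralD//; last by move=> y _; rewrite lee_fin ltW.
  by rewrite Ic.
apply: ge_ereal_inf; exists (\int[pi]_z (@mdist R T z.1 z.2)%:E).
  exists pi => // B mB; split.
    by congr (mu _); apply/seteqP; split=> z //= [].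
  by congr (mu _); apply/seteqP; split=> z //= [].
rewrite ge0_integral_distribution//.
apply: ge0_le_integral => //.
- by move=> y _; exact: d0.
- exact: emeasurable_funD msd (measurable_cst e%:E).
- by move=> y _; rewrite -EFinD lee_fin; exact: fd.
Qed.

(* [kcompose] is a bare set function, controlled on measurable sets only. *)
Lemma eq_W1set (mu mu' : set (borel T) -> \bar R) (A : set T) :
  (forall B : set (borel T), measurable B -> mu B = mu' B) ->
  W1set mu A = W1set mu' A.
Proof.
move=> mm'; suff W (m m' nu : set (borel T) -> \bar R) :
    (forall B : set (borel T), measurable B -> m B = m' B) -> W1 m nu = W1 m' nu.
  by congr (ereal_inf (_ @` _)); apply/funext => nu; exact: W.
move=> h; congr ereal_inf; apply/seteqP.
by split=> _ [pi c <-]; exists pi => // B mB; have [? ?] := c B mB;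
  split=> //; rewrite (h, esym (h _ mB)).
Qed.

End wasserstein_upper.

(** * Measures of total mass one as probabilities *)

Section unit_mass.
Context {d} {T : measurableType d} {R : realType}.
Context (mu : {measure set T -> \bar R}) (mu1 : (mu setT = 1)%E).

(** An alias of [mu] carrying the mass equation, so that a probability structure can be attached to
    it; the Giry bind used below only yields a subprobability. *)
Definition unit_mass_measure of (mu setT = 1)%E : set T -> \bar R := mu.

HB.instance Definition _ := Measure.on (unit_mass_measure mu1).

HB.instance Definition _ :=
  Measure_isProbability.Build _ _ _ (unit_mass_measure mu1) mu1.

End unit_mass.

(** * Measurability of Feller kernels and their composition *)

Section feller_kernels.
Context {R : realType} {Y Z : pointedMetricType R}.
Context (Q : Y -> probability (borel Z) R) (feller_Q : feller Q).
Local Open Scope ereal_scope.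

(* The indicator of [U] is the increasing limit of the bounded continuous
   functions [min 1 (n * d(z, ~` U))]. *)
Lemma feller_measurable_open (U : set (borel Z)) : open (U : set Z) ->
  measurable_fun setT (fun y : borel Y => Q y U).
Proof.
(* The whole space is treated apart: there the default [setdist set0 z = 0] would make the
   approximating functions vanish. *)
move=> oU; have [U0|/set0P A0] := eqVneq (~` U) set0.
  have -> : U = setT by rewrite -(setCK U) U0 setC0.
  by under eq_fun do rewrite probability_setT; exact: measurable_cst.
have cA : closed (~` U : set Z) by exact: open_closedC.
pose d := @setdist R Z (~` U).
pose phi n (z : borel Z) : R := Num.min 1%R (n%:R * d z)%R.
have phi0 n z : (0 <= phi n z)%R.
  by rewrite le_min ler01 mulr_ge0 ?ler0n ?setdist_ge0.
have cphi n : continuous (phi n : Z -> R).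
  move=> z; apply: (@continuous_min R Z (fun=> 1%R) (fun z => n%:R * d z)%R z).
    exact: cvg_cst.
  apply: cvgMr; apply: lipschitz1_continuous => a b; exact: setdist_lip.
have mphi n : measurable_fun setT (fun z => (phi n z)%:E).
  by apply/measurable_EFinP; exact: continuous_borel_measurable.
have ndphi z : {homo (fun n => (phi n z)%:E) : n m / (n <= m)%N >-> n <= m}.
  move=> n m nm; rewrite lee_fin le_min ge_min lexx/=.
  by rewrite ge_min; apply/orP; right; rewrite ler_wpM2r ?setdist_ge0 ?ler_nat.
have limphi z : limn (fun n => (phi n z)%:E) = (\1_U z)%:E.
  apply/cvg_lim => //; apply: cvg_near_cst; rewrite indicE.
  have [zU|zU] := boolP (z \in U); last first.
    apply: nearW => n; rewrite /phi /d setdist0 ?mulr0; last first.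
      by move/negP: zU; rewrite inE.
    by rewrite min_r.
  have d0 : (0 < d z)%R.
    by apply: setdist_gt0 => //=; rewrite inE in zU; apply.
  (* Once [n] exceeds the inverse of [d z], the minimum equals 1. *)
  exists (Num.truncn (d z)^-1).+1 => // n /= dn; rewrite /phi min_l//.
  rewrite -ler_pdivrMr// div1r (le_trans (ltW (truncnS_gt _)))//.
  by rewrite ler_nat.
apply: (@emeasurable_fun_cvg _ _ _ setT
    (fun n (y : borel Y) => \int[Q y]_z (phi n z)%:E)).
  move=> n; apply: continuous_borel_emeasurable; apply: feller_Q => //.
  exists 1%R => z; rewrite ger0_norm// ge_min lexx//.
move=> y _; have -> : Q y U = \int[Q y]_z limn (fun n => (phi n z)%:E).
  rewrite (eq_integral (fun z => (\1_U z)%:E)); last by move=> z _; exact: limphi.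
  by rewrite integral_indic ?setIT//; exact: borel_open.
apply: cvg_monotone_convergence => //.
by move=> n z _; rewrite lee_fin.
Qed.

(** By Dynkin's theorem: the sets [B] with measurable evaluation form a Dynkin system containing the
    open sets, which are stable under intersection. *)
Lemma feller_measurable (B : set (borel Z)) : measurable B ->
  measurable_fun setT (fun y : borel Y => Q y B).
Proof.
move: B; apply: (@dynkin_induction _ (borel Z) (@open Z)
  (fun B => measurable_fun setT (fun y : borel Y => Q y B))) => //=.
- exact: openI.
- by under eq_fun do rewrite probability_setT; exact: measurable_cst.
- by move=> U oU; exact: feller_measurable_open.
- move=> B mB mQB.
  apply: (eq_measurable_fun (fun y : borel Y => 1 - Q y B)).
    by move=> y _; rewrite probability_setC.
  exact: emeasurable_funB (measurable_cst 1) mQB.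
- move=> F mF tF mQF.
  apply: (eq_measurable_fun (fun y : borel Y => \sum_(0 <= k <oo) Q y (F k))).
    by move=> y _; rewrite measure_semi_bigcup//; exact: bigcup_measurable.
  exact: ge0_emeasurable_sum.
Qed.

(** [Q] as a map into the Giry space, where measurability is tested on evaluations at measurable
    sets. *)
Let Qgiry (y : borel Y) : giry (borel Z) R := Q y.

Let measurable_Qgiry : measurable_fun setT Qgiry.
Proof. by apply: measurable_giry_codensity => // B; exact: feller_measurable. Qed.

Lemma measurable_integral_feller (h : borel Z -> \bar R) :
  measurable_fun setT h -> (forall z, 0 <= h z) ->
  measurable_fun setT (fun y : borel Y => \int[Q y]_z h z).
Proof.
move=> mh h0.
exact: (measurableT_comp (measurable_giry_int mh h0) measurable_Qgiry).
Qed.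

(** The witness is the Giry bind of [P x] with [Q]; the integral formula is that of the bind. *)
Lemma kcompose_probability (X : Type) (P : X -> probability (borel Y) R) (x : X) :
  exists QP : probability (borel Z) R,
    (forall B : set (borel Z), measurable B -> QP B = kcompose P Q x B) /\
    (forall h : borel Z -> \bar R, measurable_fun setT h -> (forall z, 0 <= h z) ->
      \int[QP]_z h z = \int[P x]_y \int[Q y]_z h z).
Proof.
pose mu : subprobability (borel Z) R :=
  giry_bind (P x : giry (borel Y) R) measurable_Qgiry.
have muE (B : set (borel Z)) : measurable B -> mu B = kcompose P Q x B.
  move=> mB; apply: (giry_int_map measurable_Qgiry) => //.
  exact: measurable_giry_ev.
have muT : mu setT = 1.
  rewrite muE// /kcompose; under eq_integral do rewrite probability_setT.
  apply: etrans (integral_cst (P x) measurableT 1) _.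
  by rewrite mul1e; exact: probability_setT.
by exists (unit_mass_measure mu muT); split=> // h mh h0; exact: giry_int_bind.
Qed.

End feller_kernels.

(** * Estimates for a Wasserstein-Lipschitz kernel *)

Section composition.
Context {R : realType} {Y Z : pointedMetricType R}.
Context (Q : Y -> probability (borel Z) R) (L : R).
Context (L0 : 0 <= L) (sZ : separable_space Z).
Context (QL : forall y y' : Y, (W1 (Q y) (Q y') <= (L * mdist y y')%:E)%E).
Local Open Scope ereal_scope.

Lemma integral_lipschitz_kernel (phi : Z -> R) (y y' : Y) :
  (forall z, 0 <= phi z)%R -> (forall a b, phi a <= phi b + mdist a b)%R ->
  \int[Q y]_z (phi z)%:E <= \int[Q y']_z (phi z)%:E + (L * mdist y y')%:E.
Proof.
move=> phi0 lphi; apply: le_trans (W1_lipschitz (Q y) (Q y') phi sZ phi0 lphi) _.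
exact: leeD.
Qed.

Lemma integral_setdist_pullback (A : set Z) (eps : R) (y : Y) : A !=set0 ->
  let B := [set y | W1set (Q y) A <= eps%:E] in B !=set0 ->
  \int[Q y]_z (setdist A z)%:E <= (L * setdist B y + eps)%:E.
Proof.
move=> A0 B B0; apply/lee_addgt0Pr => e e0.
(* Dividing by [L + 1] also covers [L = 0], and [L * (e / (L + 1)) <= e]. *)
have e'0 : (0 < e / (L + 1))%R by rewrite divr_gt0// ltr_wpDl.
have [y' By' yy'] := setdist_approx B y _ B0 e'0.
have := integral_lipschitz_kernel (setdist A) y y' (setdist_ge0 A)
  (fun a b => setdist_lip A a b A0).
move=> /le_trans; apply.
have := le_trans (integral_setdist_le_W1set (Q y') A sZ A0) By'.
move=> /leeD /(_ (lexx (L * mdist y y')%:E)) /le_trans; apply.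
rewrite -!EFinD lee_fin [leLHS]addrC [leRHS]addrAC lerD2r.
apply: le_trans (ler_wpM2l L0 (ltW yy')) _.
rewrite mulrDr lerD2l mulrCA ger_pMr// ler_pdivrMr ?ltr_wpDl//.
by rewrite mul1r lerDl.
Qed.

(** The moment of [Q y] about [z0] is at most that of [Q y0] plus L d(y0, y), which is
    [mu]-integrable. This puts the composite in P_1, as the upper bound requires. *)
Lemma integral_mdist_kcompose_fin (mu : probability (borel Y) R) : feller Q ->
  P1 mu -> (forall y, P1 (Q y)) ->
  exists z0 : Z, \int[mu]_y \int[Q y]_z (@mdist R Z z0 z)%:E < +oo.
Proof.
move=> fQ [y0 muy0] Q1; have [z0 Qz0] := Q1 y0; exists z0.
set c := \int[Q y0]_z _ in Qz0.
have c0 : 0 <= c by apply: integral_ge0 => z _; rewrite lee_fin mdist_ge0.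
have md : measurable_fun setT (fun y : borel Y => (@mdist R Y y0 y)%:E).
  by apply/measurable_EFinP; exact: measurable_mdistr.
have mdz : measurable_fun setT (fun z : borel Z => (@mdist R Z z0 z)%:E).
  by apply/measurable_EFinP; exact: measurable_mdistr.
have md0 (y : borel Y) : 0 <= (@mdist R Y y0 y)%:E by rewrite lee_fin mdist_ge0.
have mdL : measurable_fun setT (fun y : borel Y => L%:E * (@mdist R Y y0 y)%:E).
  exact: measurable_funeM.
apply: (@le_lt_trans _ _ (\int[mu]_y (c + L%:E * (mdist y0 y)%:E))).
  apply: ge0_le_integral => //.
  - by move=> y _; apply: integral_ge0 => z _; rewrite lee_fin mdist_ge0.
  - apply: measurable_integral_feller => // z.
    by rewrite lee_fin mdist_ge0.
  - exact: emeasurable_funD (measurable_cst c) mdL.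
  - move=> y _; have := integral_lipschitz_kernel (mdist z0) y y0.
    rewrite (metric_sym y y0) EFinM; apply; first by move=> z; exact: mdist_ge0.
    exact: mdist_lip.
rewrite ge0_integralD//; last by move=> y _; rewrite mule_ge0// lee_fin.
have -> : \int[mu]_(y in setT) c = c.
  apply: etrans (integral_cst mu measurableT c) _.
  by rewrite -[RHS]mule1; congr (_ * _); exact: probability_setT.
rewrite ge0_integralZl_EFin//.
by apply: lte_add_pinfty => //; apply: lte_mul_pinfty; rewrite // lee_fin.
Qed.

End composition.

Theorem mainTheorem18 (R : realType) (X : metricType R) (Y Z : pointedMetricType R) (M : topologicalType)
  (P : X -> probability (borel Y) R) (Q : Y -> probability (borel Z) R) (L : R) :
  polish X -> polish Y -> polish Z ->
  compact [set: M] -> hausdorff_space M ->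
  feller P -> tight P -> feller Q -> tight Q ->
  (forall x, P1 (P x)) -> (forall y, P1 (Q y)) ->
  0 <= L ->
  (forall y y' : Y, (W1 (Q y) (Q y') <= (L * mdist y y')%:E)%E) ->
  forall (delta eps : R) (S : set (Z * M)%type), 0 <= delta -> 0 <= eps ->
    closed S ->
    Wpullback (kfun P) delta (Wpullback (kfun Q) eps S)
      `<=` Wpullback (kcompose P Q) (L * delta + eps) S.
Proof.
move=> _ [_ sY] [_ sZ] _ _ _ _ fQ _ P1P P1Q L0 QL delta eps S _ eps0 cS [x m].
rewrite /Wpullback/= /kfun => xm.
set A := [set z | S (z, m)].
set B := [set y | _] in xm.
have cA : closed A.
  apply: (@closed_comp _ _ (fun z : Z => (z, m)) S) => // z _.
  by apply: cvg_pair => //; exact: cvg_cst.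
(* A finite distance bound forces [B] nonempty, and any point of [B] then does the same for [A]. *)
have B0 : B !=set0 by exact: W1set_nonempty xm.
have A0 : A !=set0 by have [y By] := B0; exact: W1set_nonempty By.
have [QP [QPE intQP]] := kcompose_probability Q fQ X P x.
rewrite -(eq_W1set QP _ A QPE).
have P1QP : P1 QP.
  have [z0 h] := integral_mdist_kcompose_fin Q L L0 sZ QL (P x) fQ (P1P x) P1Q.
  exists z0; rewrite intQP// => [|z]; last by rewrite lee_fin mdist_ge0.
  by apply/measurable_EFinP; exact: measurable_mdistr.
apply: le_trans (W1set_le_integral_setdist QP A sZ cA A0 P1QP) _.
have mA : measurable_fun setT (fun z : borel Z => (setdist A z)%:E).
  by apply/measurable_EFinP; exact: measurable_setdist.
have mB : measurable_fun setT (fun y : borel Y => (setdist B y)%:E).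
  by apply/measurable_EFinP; exact: measurable_setdist.
have mLB : measurable_fun setT (fun y : borel Y => L%:E * (setdist B y)%:E)%E.
  exact: measurable_funeM.
have sA0 z : (0 <= (setdist A z)%:E)%E by rewrite lee_fin setdist_ge0.
have sB0 y : (0 <= (setdist B y)%:E)%E by rewrite lee_fin setdist_ge0.
rewrite intQP//.
apply: (@le_trans _ _ (\int[P x]_y (L%:E * (setdist B y)%:E + eps%:E))%E).
  apply: ge0_le_integral => //.
  - by move=> y _; apply: integral_ge0.
  - exact: measurable_integral_feller.
  - exact: emeasurable_funD mLB (measurable_cst eps%:E).
  - move=> y _; rewrite -EFinM -EFinD.
    exact: integral_setdist_pullback.
rewrite ge0_integralD//; last by move=> y _; rewrite mule_ge0.
rewrite ge0_integralZl_EFin// EFinD EFinM; apply: leeD.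
  apply: lee_wpmul2l; first by rewrite lee_fin.
  exact: le_trans (integral_setdist_le_W1set (P x) B sY B0) xm.
(* The constant [eps] integrates to [eps] times the mass of [P x], which is at most 1. *)
apply: le_trans (_ : (eps%:E * P x setT <= _)%E); last first.
  by rewrite -[leRHS]mule1 lee_wpmul2l ?lee_fin//; exact: probability_le1.
by rewrite -(integral_cst (P x) measurableT).
Qed.
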